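(* Let $\Gamma_1$ and $\Gamma_2$ be finite graphs such that $\Gamma_1$ co-contracts onto $\Gamma_2$. If $2\le m\le\infty$, then there is an embedding of $GP_m(\Gamma_2)$ into $GP_m(\Gamma_1)$.
   Context: A graph means a simplicial 1-complex (no loops, no multiple edges). The opposite graph $\Gamma^{\mathrm{opp}}$ has the same vertex set as $\Gamma$, and two distinct vertices are adjacent in $\Gamma^{\mathrm{opp}}$ exactly when they are non-adjacent in $\Gamma$. Contracting an edge $e=\{x,t\}$ of a graph replaces $x$ and $t$ by a single new vertex adjacent to exactly those other vertices that were adjacent to $x$ or to $t$ (the result is again simple). $\Gamma_1$ co-contracts onto $\Gamma_2$ if there is a finite sequence of edge-contractions from $\Gamma_1^{\mathrm{opp}}$ to $\Gamma_2^{\mathrm{opp}}$. For $2\le m\le\infty$, $GP_m(\Gamma)$ denotes the graph product over $\Gamma$ of cyclic groups of order $m$ (infinite cyclic if $m=\infty$): the free product of copies $G_v$ ($v\in V(\Gamma)$) of this cyclic group modulo the normal closure of $\{[g,h]: g\in G_u,h\in G_v,\{u,v\}\in E(\Gamma)\}$. *)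

(* Defs.v *)
From HB Require Import structures.
From mathcomp Require Import all_boot all_order all_algebra.
From mathcomp Require Import boolp classical_sets.

Set Implicit Arguments.
Unset Strict Implicit.
Unset Printing Implicit Defensive.

Import GRing.Theory.
Local Open Scope classical_set_scope.
Local Open Scope quotient_scope.
Local Open Scope group_scope.

Record sgraph := SGraph {
  vertex :> finType;
  adj : rel vertex;
  adj_sym : symmetric adj;
  adj_irrefl : irreflexive adj }.

Arguments adj {s}.

Definition sgraph_iso (A B : sgraph) :=
  exists2 f : A -> B, bijective f & forall u v, adj (f u) (f v) = adj u v.

Section Opposite.
Variable A : sgraph.

Definition opp_adj : rel A := fun u v => (u != v) && ~~ adj u v.

Fact opp_adj_sym : symmetric opp_adj.
Proof. by move=> u v; rewrite /opp_adj eq_sym adj_sym. Qed.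

Fact opp_adj_irrefl : irreflexive opp_adj.
Proof. by move=> u; rewrite /opp_adj eqxx. Qed.

Definition opp_graph := SGraph opp_adj_sym opp_adj_irrefl.

End Opposite.

(* [None] is the vertex replacing x and t.  This is an edge-contraction only  *)
(* when [adj x t], which [contracts_onto] requires.                           *)
Section Contraction.
Variables (A : sgraph) (x t : A).

Definition contract_vertex := option {v : A | (v != x) && (v != t)}.

Definition contract_adj : rel contract_vertex := fun a b =>
  match a, b with
  | Some u, Some v => adj (val u) (val v)
  | Some u, None | None, Some u => adj x (val u) || adj t (val u)
  | None, None => false
  end.

Fact contract_adj_sym : symmetric contract_adj.
Proof. by move=> [u|] [v|] //=; rewrite adj_sym. Qed.

Fact contract_adj_irrefl : irreflexive contract_adj.
Proof. by move=> [u|] //=; rewrite adj_irrefl. Qed.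

Definition contract := SGraph contract_adj_sym contract_adj_irrefl.

End Contraction.

(* A finite, possibly empty, sequence of edge-contractions; graphs are taken  *)
(* up to isomorphism.                                                         *)
Inductive contracts_onto : sgraph -> sgraph -> Prop :=
| contracts_iso (A B : sgraph) : sgraph_iso A B -> contracts_onto A B
| contracts_step (A B : sgraph) (x t : A) :
    adj x t -> contracts_onto (contract x t) B -> contracts_onto A B.

Definition co_contracts_onto (A B : sgraph) :=
  contracts_onto (opp_graph A) (opp_graph B).

(* The free product of a family of groups: words in the disjoint union of the *)
(* factors, up to the congruence identifying the identities with the empty    *)
(* word and a product in a factor with the two-letter word of its terms.      *)
Section FreeProduct.
Variables (V : Type) (G : V -> groupType).

Definition word := {classic seq {v : V & G v}}.

Definition letter v (g : G v) : {v : V & G v} := existT (fun v => G v : Type) v g.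

Inductive word_cong : word -> word -> Prop :=
| word_cong_refl w : word_cong w w
| word_cong_sym w1 w2 : word_cong w1 w2 -> word_cong w2 w1
| word_cong_trans w1 w2 w3 :
    word_cong w1 w2 -> word_cong w2 w3 -> word_cong w1 w3
| word_cong_cat w1 w2 w3 w4 :
    word_cong w1 w2 -> word_cong w3 w4 -> word_cong (w1 ++ w3) (w2 ++ w4)
| word_cong_one v : word_cong [:: letter (1 : G v)] [::]
| word_cong_mul v (g h : G v) :
    word_cong [:: letter g; letter h] [:: letter (g * h)].

Definition word_eq : rel word := fun w1 w2 => `[< word_cong w1 w2 >].

Fact word_eq_refl : reflexive word_eq.
Proof. by move=> w; apply/asboolP; apply: word_cong_refl. Qed.

Fact word_eq_sym : symmetric word_eq.
Proof. by move=> w1 w2; apply/asboolP/asboolP; apply: word_cong_sym. Qed.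

Fact word_eq_trans : transitive word_eq.
Proof.
move=> w2 w1 w3 /asboolP h12 /asboolP h23; apply/asboolP.
exact: word_cong_trans h12 h23.
Qed.

Canonical word_equiv := EquivRel word_eq word_eq_refl word_eq_sym word_eq_trans.

Definition free_product := {eq_quot word_equiv}.
HB.instance Definition _ := Choice.on free_product.

Definition word_inv (w : word) : word :=
  rev (map (fun l => letter (projT2 l : G (projT1 l))^-1) w).

Definition free_one : free_product := \pi_(free_product) ([::] : word).
Definition free_mul (a b : free_product) : free_product :=
  \pi_(free_product) ((repr a ++ repr b) : word).
Definition free_inv (a : free_product) : free_product :=
  \pi_(free_product) (word_inv (repr a)).

Lemma word_piP (w1 w2 : word) :
  reflect (word_cong w1 w2)
    (\pi_(free_product) w1 == \pi_(free_product) w2).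
Proof. by rewrite (@eqquotE _ _ {eq_quot word_equiv}); apply: asboolP. Qed.

Lemma word_reprP (w : word) : word_cong (repr (\pi_(free_product) w)) w.
Proof. by apply/word_piP; rewrite reprK. Qed.

Lemma free_mul_pi (w1 w2 : word) :
  free_mul (\pi w1) (\pi w2) = \pi_(free_product) ((w1 ++ w2) : word).
Proof. by apply/eqP/word_piP; apply: word_cong_cat; apply: word_reprP. Qed.

Lemma word_inv_cat (w1 w2 : word) :
  word_inv (w1 ++ w2) = word_inv w2 ++ word_inv w1.
Proof. by rewrite /word_inv map_cat rev_cat. Qed.

Lemma word_inv_letter v (g : G v) :
  word_cong [:: letter g; letter g^-1] [::].
Proof.
apply: word_cong_trans (word_cong_mul _ _) _.
by rewrite mulgV; apply: word_cong_one.
Qed.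

Lemma word_invK (w : word) : word_inv (word_inv w) = w.
Proof.
rewrite /word_inv map_rev revK -map_comp -[RHS]map_id.
by apply: eq_map => -[v g]; rewrite /= invgK.
Qed.

Lemma word_mulV (w : word) : word_cong (w ++ word_inv w) [::].
Proof.
elim: w => [|[v g] w IHw]; first exact: word_cong_refl.
have -> : ((existT _ v g :: w) ++ word_inv (existT _ v g :: w) : word) =
    ([:: letter g] ++ ((w ++ word_inv w) ++ [:: letter g^-1]) : word).
  by rewrite /word_inv /= rev_cons -cats1 !catA.
apply: word_cong_trans (word_inv_letter g).
apply: (@word_cong_cat [:: letter g] [:: letter g]); first exact: word_cong_refl.
exact: word_cong_cat IHw (word_cong_refl [:: letter g^-1]).
Qed.

Lemma word_mulVw (w : word) : word_cong (word_inv w ++ w) [::].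
Proof. by have := word_mulV (word_inv w); rewrite word_invK. Qed.

Fact free_mulA : associative free_mul.
Proof.
elim/quotW=> a; elim/quotW=> b; elim/quotW=> c.
by rewrite !free_mul_pi catA.
Qed.

Fact free_mul1g : left_id free_one free_mul.
Proof. by elim/quotW=> a; rewrite free_mul_pi. Qed.

Fact free_mulg1 : right_id free_one free_mul.
Proof. by elim/quotW=> a; rewrite free_mul_pi cats0. Qed.

Fact free_mulVg : left_inverse free_one free_inv free_mul.
Proof.
move=> a; rewrite -{2}[a]reprK /free_inv free_mul_pi.
exact/eqP/word_piP/word_mulVw.
Qed.

Fact free_mulgV : right_inverse free_one free_inv free_mul.
Proof.
move=> a; rewrite -{1}[a]reprK /free_inv free_mul_pi.
exact/eqP/word_piP/word_mulV.
Qed.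

HB.instance Definition _ := isGroup.Build free_product
  free_mulA free_mul1g free_mulg1 free_mulVg free_mulgV.

Definition free_in v (g : G v) : free_product :=
  \pi_(free_product) ([:: letter g] : word).

End FreeProduct.

Record normal_subgroup (F : groupType) (N : set F) : Prop := NormalSubgroup {
  normal_one : N 1;
  normal_mul : forall x y, N x -> N y -> N (x * y);
  normal_inv : forall x, N x -> N x^-1;
  normal_conj : forall x y, N x -> N (x ^ y) }.

Definition normal_closure (F : groupType) (S : set F) : set F :=
  smallest (@normal_subgroup F) S.

Lemma normal_closure_normal (F : groupType) (S : set F) :
  normal_subgroup (normal_closure S).
Proof.
split.
- by move=> N [nN _]; apply: normal_one.
- move=> x y Sx Sy N SN; have [nN _] := SN.
  exact: normal_mul (Sx N SN) (Sy N SN).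
- by move=> x Sx N SN; have [nN _] := SN; apply: normal_inv (Sx N SN).
- by move=> x y Sx N SN; have [nN _] := SN; apply: normal_conj (Sx N SN).
Qed.

Section QuotientByNormalClosure.
Variables (F : groupType) (S : set F).

Definition coset_eq : rel F := fun x y => `[< normal_closure S (x^-1 * y) >].

Fact coset_eq_refl : reflexive coset_eq.
Proof.
move=> x; apply/asboolP; rewrite mulVg.
exact: normal_one (normal_closure_normal S).
Qed.

Fact coset_eq_sym : symmetric coset_eq.
Proof.
by move=> x y; apply/asboolP/asboolP => /(normal_inv (normal_closure_normal S));
  rewrite invgM invgK.
Qed.

Fact coset_eq_trans : transitive coset_eq.
Proof.
move=> y x z /asboolP Nxy /asboolP Nyz; apply/asboolP.
have := normal_mul (normal_closure_normal S) Nxy Nyz.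
by rewrite mulgA mulgK.
Qed.

Canonical coset_equiv :=
  EquivRel coset_eq coset_eq_refl coset_eq_sym coset_eq_trans.

Definition normal_quotient := {eq_quot coset_equiv}.
HB.instance Definition _ := Choice.on normal_quotient.

Definition quot_one : normal_quotient := \pi_(normal_quotient) 1.
Definition quot_mul (a b : normal_quotient) : normal_quotient :=
  \pi_(normal_quotient) (repr a * repr b).
Definition quot_inv (a : normal_quotient) : normal_quotient :=
  \pi_(normal_quotient) (repr a)^-1.

Lemma coset_piP (x y : F) :
  reflect (normal_closure S (x^-1 * y))
    (\pi_(normal_quotient) x == \pi_(normal_quotient) y).
Proof. by rewrite (@eqquotE _ _ {eq_quot coset_equiv}); apply: asboolP. Qed.

Lemma coset_reprP (x : F) :
  normal_closure S ((repr (\pi_(normal_quotient) x))^-1 * x).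
Proof. by apply/coset_piP; rewrite reprK. Qed.

Lemma quot_mul_pi (x y : F) :
  quot_mul (\pi x) (\pi y) = \pi_(normal_quotient) (x * y).
Proof.
apply/eqP/coset_piP; set x' := repr _; set y' := repr _.
have nN := normal_closure_normal S.
have -> : (x' * y')^-1 * (x * y) = ((x'^-1 * x) ^ y') * (y'^-1 * y).
  by rewrite conjgE invgM !mulgA mulgK.
apply: (normal_mul nN); last exact: coset_reprP.
by apply: (normal_conj nN); apply: coset_reprP.
Qed.

Fact quot_mulA : associative quot_mul.
Proof.
elim/quotW=> a; elim/quotW=> b; elim/quotW=> c.
by rewrite !quot_mul_pi mulgA.
Qed.

Fact quot_mul1g : left_id quot_one quot_mul.
Proof. by elim/quotW=> a; rewrite quot_mul_pi mul1g. Qed.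

Fact quot_mulg1 : right_id quot_one quot_mul.
Proof. by elim/quotW=> a; rewrite quot_mul_pi mulg1. Qed.

Fact quot_mulVg : left_inverse quot_one quot_inv quot_mul.
Proof.
by move=> a; rewrite -{2}[a]reprK /quot_inv quot_mul_pi mulVg.
Qed.

Fact quot_mulgV : right_inverse quot_one quot_inv quot_mul.
Proof.
by move=> a; rewrite -{1}[a]reprK /quot_inv quot_mul_pi mulgV.
Qed.

HB.instance Definition _ := isGroup.Build normal_quotient
  quot_mulA quot_mul1g quot_mulg1 quot_mulVg quot_mulgV.

End QuotientByNormalClosure.

Definition graph_relators (A : sgraph) (G : A -> groupType) :
    set (free_product G) :=
  [set r | exists u v (g : G u) (h : G v),
     adj u v /\ r = [~ free_in g, free_in h] ].

Arguments graph_relators {A} G _.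

Definition graph_product (A : sgraph) (G : A -> groupType) : groupType :=
  normal_quotient (graph_relators G).

(* The additive group of [int], written multiplicatively. *)
Definition int_group := int.
HB.instance Definition _ := Choice.on int_group.
HB.instance Definition _ := isGroup.Build int_group
  (@addrA int) (@add0r int) (@addr0 int) (@addNr int) (@addrN int).

(* [None] stands for the infinite order.  [Some n] gives the cyclic group of  *)
(* order n only for n >= 2, since ['Z_0] and ['Z_1] are both ['Z_2].          *)
Definition cyclic_group (m : option nat) : groupType :=
  if m is Some n then 'Z_n : groupType else int_group : groupType.

Definition GP (m : option nat) (A : sgraph) : groupType :=
  graph_product (fun _ : A => cyclic_group m).

(* Main.v *)
(* Only one contraction of an edge {x, t} of the opposite graph matters. Let  *)
(* z be the new vertex, and T a nontrivial element of the vertex group of t.  *)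
(* The embedding fixes the old vertices and sends the vertex group of z to    *)
(* the conjugate by T of that of x: an old vertex is adjacent to z in the     *)
(* co-contraction exactly when it is adjacent to both x and t.                *)
(* For injectivity, the graph product acts on the reduced words of a free     *)
(* product of copies of the vertex group of x, indexed by the cosets of       *)
(* <link x>. Write an element of the co-contraction as a product of           *)
(* conjugates k_i c_i k_i^-1 followed by k, with c_i in the vertex group of z *)
(* and k_i, k generated by old vertices. Its image sends the empty word to    *)
(* the reduced word with syllables c_i at the cosets k_i T^-1 <link x>, as    *)
(* soon as k_i T^-1 <link x> = k_j T^-1 <link x> only when k_i^-1 k_j lies in *)
(* <link x> and in <link t>, that is in <link z>. So an element of the kernel *)
(* is some k, and the old vertices generate isomorphic subgroups.             *)

From HB Require Import structures.
From mathcomp Require Import all_boot.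
From mathcomp Require Import ssrint boolp classical_sets.
Require Import Defs.

Set Implicit Arguments.
Unset Strict Implicit.
Unset Printing Implicit Defensive.

Local Open Scope quotient_scope.
Local Open Scope group_scope.

(** Embeddings compose and a double opposite is the original graph, so one contraction suffices.
    There [cocontraction_morphism] supplies the map phi, and the danger is that conjugates of the
    new vertex group acquire extra relations in the image. The action of [reduced_word_action]
    excludes this: [normal_form] follows the empty word under phi g and reads off the conjugates in
    a factorization of g. When a coset matches the one at the front, [label_inj] lets the two
    syllables merge already in the source. It rests on [commute_supported], itself a consequence of
    the action. If phi g is trivial, no conjugates remain and g lies in the subgroup of the old
    vertices, where the deletion of x and t inverts phi. *)

Definition quot_proj (F : groupType) (S : set F) (x : F) : normal_quotient S :=
  \pi_(normal_quotient S) x.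

Fact quot_projM (F : groupType) (S : set F) :
  {morph @quot_proj F S : x y / x * y}.
Proof. by move=> x y; apply/esym/quot_mul_pi. Qed.

HB.instance Definition _ (F : groupType) (S : set F) :=
  isMultiplicative.Build F (normal_quotient S) (@quot_proj F S)
    (@quot_projM F S).
HB.instance Definition _ (F : groupType) (S : set F) :=
  Multiplicative_isUMagmaMorphism.Build F (normal_quotient S) (@quot_proj F S)
    (erefl 1).

(** * Universal property of graph products *)

Section Presentation.
Variables (A : sgraph) (G : A -> groupType).

Definition gen v (g : G v) : graph_product G :=
  quot_proj (graph_relators G) (free_in g).

Lemma genM v : {morph @gen v : g h / g * h}.
Proof.
move=> g h; rewrite /gen -gmulfM; congr quot_proj.
apply: etrans (esym (free_mul_pi _ _)); apply/esym/eqP/word_piP.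
exact: word_cong_mul.
Qed.

HB.instance Definition _ v :=
  isMultiplicative.Build (G v) (graph_product G) (@gen v) (@genM v).

Lemma gen1 v : gen (1 : G v) = 1.
Proof. by apply/(mulgI (gen (1 : G v))); rewrite -genM !mulg1. Qed.

HB.instance Definition _ v :=
  Multiplicative_isUMagmaMorphism.Build (G v) (graph_product G) (@gen v)
    (@gen1 v).

Lemma gen_commute u v (g : G u) (h : G v) : adj u v -> commute (gen g) (gen h).
Proof.
move=> uv; apply/commgP; rewrite /gen -gmulfR.
rewrite -(gmulf1 : quot_proj (graph_relators G) 1 = 1).
rewrite eq_sym; apply/coset_piP => N [_ SN]; apply: SN.
by rewrite invg1 mul1g; exists u, v, g, h.
Qed.

Lemma graph_product_ind (P : graph_product G -> Prop) :
    P 1 -> (forall v (g : G v) y, P y -> P (gen g * y)) ->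
  forall y, P y.
Proof.
move=> P1 Pgen; elim/quotW => x; rewrite -[\pi x]/(quot_proj _ x).
elim/quotW: x => w; elim: w => [|[v g] w IHw]; first exact: P1.
have -> : \pi_(free_product G) ((existT _ v g :: w) : word G)
  = free_in g * \pi_(free_product G) w by apply/esym/free_mul_pi.
by rewrite gmulfM; apply: Pgen.
Qed.

Section Lift.
Variables (H : monoidType) (f : forall v, G v -> H).
Hypotheses (f1 : forall v, f (1 : G v) = 1)
  (fM : forall v, {morph @f v : g h / g * h})
  (fC : forall u v (g : G u) (h : G v), adj u v -> commute (f g) (f h)).

Let word_eval (w : word G) : H :=
  foldr (fun l y => f (projT2 l : G (projT1 l)) * y) 1 w.

Let word_eval_cat (w w' : word G) :
  word_eval (w ++ w' : word G) = word_eval w * word_eval w'.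
Proof. by elim: w => [|l w IHw] /=; rewrite ?mul1g // IHw mulgA. Qed.

Let word_eval_cong (w w' : word G) :
  word_cong w w' -> word_eval w = word_eval w'.
Proof.
elim=> //=.
- by move=> w1 w2 w3 _ -> _.
- by move=> w1 w2 w3 w4 _ E12 _ E34; rewrite !word_eval_cat E12 E34.
- by move=> v; rewrite f1 mulg1.
- by move=> v g h; rewrite fM mulgA.
Qed.

Let free_eval (x : free_product G) : H := word_eval (repr x).

Let free_eval_pi (w : word G) : free_eval (\pi w) = word_eval w.
Proof. exact/word_eval_cong/word_reprP. Qed.

Let free_evalM : {morph free_eval : x y / x * y}.
Proof.
elim/quotW=> a; elim/quotW=> b.
by rewrite -[_ * _]/(free_mul _ _) free_mul_pi !free_eval_pi word_eval_cat.
Qed.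

Let free_eval1 : free_eval 1 = 1.
Proof. by rewrite -[1]/(\pi_(free_product G) ([::] : word G)) free_eval_pi. Qed.

(** [H] need not have inverses, so quotients are formed in the source. *)
Let free_evalV x y : free_eval x = free_eval y -> free_eval (x^-1 * y) = 1.
Proof. by move=> xy; rewrite free_evalM -xy -free_evalM mulVg. Qed.

Let free_eval_kernel (x : free_product G) :
  normal_closure (graph_relators G) x -> free_eval x = 1.
Proof.
move=> Nx; apply: (Nx (fun y => free_eval y = 1)).
split=> [|r [u [v [g [h [uv ->]]]]]].
  split=> // [x1 y1 Ex Ey|x1 Ex|x1 y1 Ex].
  - by rewrite free_evalM Ex Ey mulg1.
  - by rewrite -[x1^-1]mulg1; apply: free_evalV; rewrite Ex.
  - apply: free_evalV; rewrite free_evalM Ex mul1g //.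
(* The commutator of a and b is (b a)^-1 (a b). *)
rewrite commgEl conjgE mulgA -invgM; apply: free_evalV; rewrite !free_evalM.
by rewrite !free_eval_pi /= !mulg1; apply/esym/fC.
Qed.

(** The target is a monoid, so that an action can be given by self-maps without exhibiting their
    inverses. *)
Lemma graph_product_lift :
  exists F : UMagmaMorphism.type (graph_product G) H,
    forall v (g : G v), F (gen g) = f g.
Proof.
pose F (y : graph_product G) := free_eval (repr y).
have F_pi x : F (quot_proj _ x) = free_eval x.
  set r := quot_proj _ x.
  rewrite -(mulVKg (repr r) x) free_evalM.
  by rewrite [X in _ * X]free_eval_kernel ?mulg1 //; apply: coset_reprP.
have F1 : F 1 = 1.
  rewrite -(gmulf1 : quot_proj (graph_relators G) 1 = 1).
  by rewrite F_pi free_eval1.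
have FM : {morph F : x y / x * y}.
  elim/quotW=> a; elim/quotW=> b.
  rewrite -![\pi _]/(quot_proj (graph_relators G) _) -gmulfM.
  by rewrite !F_pi free_evalM.
pose isF := isUMagmaMorphism.Build _ _ F (F1, FM).
pose F' : UMagmaMorphism.type (graph_product G) H := HB.pack F isF.
by exists F' => v g; rewrite /= F_pi free_eval_pi /= mulg1.
Qed.
End Lift.
End Presentation.

Lemma graph_product_ext (A : sgraph) (G : A -> groupType) (H : monoidType)
    (F F' : UMagmaMorphism.type (graph_product G) H) :
  (forall v (g : G v), F (gen g) = F' (gen g)) -> F =1 F'.
Proof.
move=> FF'; elim/graph_product_ind => [|v g y IHy]; first by rewrite !gmulf1.
by rewrite !gmulfM FF' IHy.
Qed.

Definition endo (T : Type) := T -> T.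
HB.instance Definition _ (T : Type) := gen_eqMixin (endo T).
HB.instance Definition _ (T : Type) := gen_choiceMixin (endo T).
HB.instance Definition _ (T : Type) := isMonoid.Build (endo T)
  (fun f g h => erefl : f \o (g \o h) = (f \o g) \o h)
  (fun f => erefl : id \o f = f) (fun f => erefl : f \o id = f).

(** * Normal forms in a free product of copies of one group *)

Section Syllables.
Variables (X : eqType) (C : groupType).
Implicit Types (p q : X) (c d : C) (s : seq (X * C)).

Definition reduced s :=
  all (fun a => a.2 != 1) s && sorted (fun a b => a.1 != b.1) s.

Definition avoids p s := if s is a :: _ then a.1 != p else true.

(** The default component 1 lets every reduced word be rebuilt by [attach], whether or not it starts
    at p. *)
Definition detach p s : C * seq (X * C) :=
  if s is (q, d) :: s' then if q == p then (d, s') else (1, s) else (1, s).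

Definition attach p d s := if d == 1 then s else (p, d) :: s.

(* Van der Waerden's action of the free factor indexed by p on the normal     *)
(* forms of a free product of copies of C.                                    *)
Definition twist p c s := let: (d, s') := detach p s in attach p (c * d) s'.

Lemma reduced_cons p c s :
  reduced ((p, c) :: s) = [&& c != 1, avoids p s & reduced s].
Proof.
rewrite /reduced /=; case: s => [|[q d] s] /=; first by rewrite !andbT.
rewrite [p == q]eq_sym.
by do !case: (_ != _) => //=; rewrite ?andbF.
Qed.

Lemma detachP p s : reduced s ->
  [/\ reduced (detach p s).2, avoids p (detach p s).2
    & attach p (detach p s).1 (detach p s).2 = s].
Proof.
case: s => [|[q d] s] /=; first by rewrite /attach eqxx.
case: (eqVneq q p) => [->|qp] red; last by rewrite /attach /= eqxx.
move: red; rewrite reduced_cons => /and3P[d1 av red].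
by rewrite /attach (negPf d1).
Qed.

Lemma attachK p d s : avoids p s -> detach p (attach p d s) = (d, s).
Proof.
rewrite /attach; case: (eqVneq d 1) => [->|_] /=; last by rewrite eqxx.
by case: s => [|[q e] s] //= /negPf->.
Qed.

Lemma reduced_twist p c s : reduced s -> reduced (twist p c s).
Proof.
move=> /(detachP p); rewrite /twist; case: (detach p s) => d s' [/= red av _].
rewrite /attach; case: (eqVneq (c * d) 1) => // cd1.
by rewrite reduced_cons cd1 av.
Qed.

Lemma twist1 p s : reduced s -> twist p 1 s = s.
Proof.
move=> /(detachP p)[_ _]; rewrite /twist; case: (detach p s) => d s' /=.
by rewrite mul1g.
Qed.

Lemma twistM p c d s :
  reduced s -> twist p (c * d) s = twist p c (twist p d s).
Proof.
move=> /(detachP p)[_]; rewrite /twist; case: (detach p s) => e s' /= av _.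
by rewrite attachK // mulgA.
Qed.

Definition relabel (f : X -> X) s := [seq (f a.1, a.2) | a <- s].

Lemma relabel_comp f g s : relabel f (relabel g s) = relabel (f \o g) s.
Proof. by rewrite /relabel -map_comp. Qed.

Lemma relabel_reduced f s : injective f -> reduced (relabel f s) = reduced s.
Proof.
move=> f_inj; elim: s => [|[p c] s IHs] //.
rewrite [relabel f _]/= !reduced_cons IHs; congr [&& _, _ & _].
by case: s {IHs} => [|[q d] s] //=; rewrite (inj_eq f_inj).
Qed.

Lemma relabel_twist f p c s :
  injective f -> relabel f (twist p c s) = twist (f p) c (relabel f s).
Proof.
move=> f_inj; have attachE d s' :
    relabel f (attach p d s') = attach (f p) d (relabel f s').
  by rewrite /attach; case: ifP.
rewrite /twist; case: s => [|[q d] s] /=; first by rewrite attachE.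
by rewrite (inj_eq f_inj); case: ifP => _; rewrite attachE.
Qed.

End Syllables.

(** * Subgroups generated by sets of vertices, and cosets of links *)

Section Parabolic.
Variable C : groupType.
Local Notation GC A := (graph_product (fun _ : vertex A => C)).
Local Notation vgen v c := (@gen _ (fun=> C) v c).

(** [None] kills a vertex group, so retractions, deletions and isomorphisms are all instances. *)
Lemma vertex_map (A B : sgraph) (s : A -> option B) :
    (forall u v u' v', adj u v -> s u = Some u' -> s v = Some v' ->
      adj u' v') ->
  exists F : UMagmaMorphism.type (GC A) (GC B),
    forall v c, F (vgen v c) = if s v is Some w then vgen w c else 1.
Proof.
move=> sP; apply: graph_product_lift.
- by move=> v; case: (s v) => [w|//]; rewrite gmulf1.
- by move=> v g h; case: (s v) => [w|]; rewrite ?gmulfM ?mulg1.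
- move=> u v g h uv; case Eu: (s u) => [u'|]; last exact/commute_sym/commute1.
  case Ev: (s v) => [v'|]; last exact: commute1.
  exact/gen_commute/(sP _ _ _ _ uv).
Qed.

Variable A : sgraph.

Fact retraction_subproof (S : pred A) :
  exists F : UMagmaMorphism.type (GC A) (GC A),
    forall v c, F (vgen v c) = if S v then vgen v c else 1.
Proof.
have [|F FE] := @vertex_map A A (fun v => if S v then Some v else None).
  by move=> u v u' v' uv; case: (S u) => // -[<-]; case: (S v) => // -[<-].
by exists F => v c; rewrite FE; case: (S v).
Qed.

Definition retraction (S : pred A) : UMagmaMorphism.type (GC A) (GC A) :=
  projT1 (cid (retraction_subproof S)).

Lemma retractionE (S : pred A) v c :
  retraction S (vgen v c) = if S v then vgen v c else 1.
Proof. exact: (projT2 (cid (retraction_subproof S))). Qed.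

(* Membership in the subgroup generated by the vertices of S. *)
Definition supported (S : pred A) (g : GC A) := retraction S g = g.

Lemma supported1 S : supported S 1.
Proof. exact: gmulf1. Qed.

Lemma supportedM S g h : supported S g -> supported S h -> supported S (g * h).
Proof. by rewrite /supported gmulfM => -> ->. Qed.

Lemma supportedV S g : supported S g -> supported S g^-1.
Proof. by rewrite /supported gmulfV => ->. Qed.

Lemma supported_gen (S : pred A) v c : S v -> supported S (vgen v c).
Proof. by move=> Sv; rewrite /supported retractionE Sv. Qed.

Lemma supported_retraction (S : pred A) g : supported S (retraction S g).
Proof.
elim/graph_product_ind: g => [|v c g IHg].
  by rewrite gmulf1; apply: supported1.
rewrite gmulfM; apply: supportedM => //; rewrite retractionE.
by case: ifP => [/supported_gen|_]; [apply | apply: supported1].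
Qed.

Lemma supported_ind (S : pred A) (P : GC A -> Prop) :
    P 1 -> (forall v c g, S v -> P g -> P (vgen v c * g)) ->
  forall g, supported S g -> P g.
Proof.
move=> P1 Pgen g <-; elim/graph_product_ind: g => [|v c g IHg].
  by rewrite gmulf1.
rewrite gmulfM retractionE; case: ifP => [Sv|_]; last by rewrite mul1g.
exact: Pgen.
Qed.

Lemma supportedS (S T : pred A) g :
  subpred S T -> supported S g -> supported T g.
Proof.
move=> ST; elim/supported_ind => [|v c h /ST Tv]; first exact: supported1.
exact/supportedM/supported_gen.
Qed.

Lemma supported_commute x c g : supported (adj x) g -> commute (vgen x c) g.
Proof.
elim/supported_ind => [|v d h xv IHh]; first exact: commute1.
by apply: commuteM => //; apply: gen_commute.
Qed.

(** All subsets are allowed as labels, so that left translation is total; the labels of interest are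
    the left cosets of <link x>. *)
Definition coset_label := set (GC A).

Definition translate (g : GC A) (Y : coset_label) : coset_label :=
  fun h => Y (g^-1 * h).

Definition link_coset x : coset_label := supported (adj x).

Lemma translate1 : translate 1 = id.
Proof.
by apply/funext => Y; apply/funext => h; rewrite /translate invg1 mul1g.
Qed.

Lemma translateM g h : translate (g * h) = translate g \o translate h.
Proof.
by apply/funext => Y; apply/funext => k; rewrite /translate /= invgM mulgA.
Qed.

Lemma translateK g : cancel (translate g) (translate g^-1).
Proof.
move=> Y; rewrite -[LHS]/((translate _ \o translate _) Y) -translateM.
by rewrite mulVg translate1.
Qed.

Lemma translate_inj g : injective (translate g).
Proof. exact: can_inj (translateK g). Qed.

Lemma translate_link x g h :
  translate g (link_coset x) = translate h (link_coset x) <->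
  supported (adj x) (h^-1 * g).
Proof.
split=> [E|sup].
  have: translate g (link_coset x) g.
    by rewrite /translate mulVg; apply: supported1.
  by rewrite E.
apply/funext => k; apply/propext; split=> supk.
  rewrite /translate -(mulVKg g k) mulgA; exact: supportedM.
rewrite /translate -(mulVKg h k) mulgA -[g^-1 * h]invgK invgM invgK.
by apply: supportedM => //; apply: supportedV.
Qed.

Definition reduced_word := {s : seq (coset_label * C) | reduced s}.

Definition empty_word : reduced_word :=
  exist (fun s => reduced s) [::] isT.

(* The kernel of the retraction killing x is the free product of the          *)
(* conjugates of its vertex group, indexed by the cosets of <link x>; this is *)
(* the action of the graph product on the normal forms of that free product.  *)
Lemma reduced_word_action x :
  exists F : UMagmaMorphism.type (GC A) (endo reduced_word),
    (forall c w, val (F (vgen x c) w) = twist (link_coset x) c (val w)) /\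
    (forall k w, supported (predC1 x) k ->
       val (F k w) = relabel (translate k) (val w)).
Proof.
pose tw c (w : reduced_word) : reduced_word :=
  exist (fun s => reduced s) _ (reduced_twist (link_coset x) c (valP w)).
have rlP g (w : reduced_word) : reduced (relabel (translate g) (val w)).
  by rewrite relabel_reduced ?(valP w) //; apply: translate_inj.
pose rl g (w : reduced_word) : reduced_word :=
  exist (fun s => reduced s) _ (rlP g w).
have rlM g h : rl (g * h) = rl g \o rl h.
  by apply/funext => w; apply: val_inj; rewrite /= relabel_comp translateM.
have rl1 : rl 1 = id.
  apply/funext => w; apply: val_inj; rewrite /= translate1.
  by rewrite /relabel -[RHS]map_id; apply: eq_map => -[].
pose f v c : endo reduced_word := if v == x then tw c else rl (vgen v c).
(* A neighbour of x fixes the coset <link x>, so its relabelling commutes with the twist there. *)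
have twrl c v d : adj x v -> tw c \o rl (vgen v d) = rl (vgen v d) \o tw c.
  move=> xv; apply/funext => w; apply: val_inj => /=.
  rewrite relabel_twist; last exact: translate_inj.
  congr twist.
  apply/esym/(etrans _ (congr1 (@^~ (link_coset x)) translate1)).
  by apply/translate_link; rewrite invg1 mul1g; apply: supported_gen.
have f1 v : f v 1 = 1.
  rewrite /f; case: eqP => _; last by rewrite gmulf1 rl1.
  by apply/funext => w; apply: val_inj; rewrite /= twist1 // (valP w).
have fM v : {morph f v : g h / g * h}.
  move=> g h; rewrite /f; case: eqP => _; last by rewrite gmulfM rlM.
  by apply/funext => w; apply: val_inj; rewrite /= twistM // (valP w).
have fC u v g h : adj u v -> commute (f u g) (f v h).
  rewrite /f; case: (eqVneq u x) => [->|ux]; case: (eqVneq v x) => [->|vx].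
  - by rewrite adj_irrefl.
  - exact: twrl.
  - by rewrite adj_sym => xu; apply/esym/twrl.
  - by move=> uv; rewrite /commute -[_ * _]rlM -[RHS]rlM (gen_commute _ _ uv).
have [F FE] := graph_product_lift f1 fM fC; exists F; split=> [c w|k w supk].
  by rewrite FE /f eqxx.
suff -> : F k = rl k by [].
elim/supported_ind: supk => [|v c g vx IHg]; first by rewrite gmulf1 rl1.
by rewrite gmulfM FE IHg rlM /f (negPf vx).
Qed.

(** Applied to the empty word in the two orders, g and c give the syllable c at g <link x> and at
    <link x>; hence these cosets agree. *)
Lemma commute_supported x (c : C) g : c != 1 -> supported (predC1 x) g ->
  commute g (vgen x c) -> supported (adj x) g.
Proof.
move=> c1 supg; have [F [Fx Fsup]] := reduced_word_action x.
move=> gx; have: val (F g (F (vgen x c) empty_word))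
  = val (F (vgen x c) (F g empty_word)).
  by rewrite -[F g (F _ _)]/((F g * F _) _) -gmulfM gx gmulfM.
rewrite Fx !(Fsup _ _ supg) Fx /= /twist /attach /= mulg1 (negPf c1) /=.
move=> [E]; rewrite -[g]mul1g -invg1.
by apply/translate_link; rewrite E translate1.
Qed.

End Parabolic.

(** * The embedding for a single co-contraction *)

Section Contraction.
Variables (C : groupType) (P : sgraph) (x t : P) (tau : C).
Hypotheses (xt : adj x t) (tau1 : tau != 1).
Local Notation GC A := (graph_product (fun _ : vertex A => C)).
Local Notation vgen v c := (@gen _ (fun=> C) v c).
Local Notation A := (opp_graph P).
Local Notation B := (opp_graph (contract x t)).

Local Notation old_vertex := {v : P | (v != x) && (v != t)}.

Let old (v : old_vertex) : B := Some v.
Let z : B := None.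

Let tx : (t == x) = false.
Proof. by apply/eqP => tx; move: xt; rewrite tx adj_irrefl. Qed.

Let adj_A_xt : adj (x : A) (t : A) = false.
Proof. by rewrite /adj /= /opp_adj xt andbF. Qed.

Let adj_B_z (u : old_vertex) :
  adj z (old u) = adj (x : A) (val u : A) && adj (t : A) (val u : A).
Proof.
have /andP[ux ut] := valP u.
by rewrite /adj /= /opp_adj /= negb_or [x == _]eq_sym [t == _]eq_sym ux ut.
Qed.

Fact cocontraction_morphism :
  exists F : UMagmaMorphism.type (GC B) (GC A),
    (forall (u : old_vertex) c, F (vgen (old u) c) = vgen (val u : A) c) /\
    (forall c, F (vgen z c) = vgen (x : A) c ^ vgen (t : A) tau).
Proof.
pose f (v : B) c : GC A :=
  if v is Some u then vgen (val u : A) c else vgen (x : A) c ^ vgen (t : A) tau.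
have fz u c d : adj z (old u) -> commute (f z c) (f (old u) d).
  rewrite adj_B_z => /andP[xu tu]; rewrite /f /= conjgE.
  have xuC := @gen_commute A (fun=> C) _ _ c d xu.
  have tuC := @gen_commute A (fun=> C) _ _ tau d tu.
  apply/commute_sym; apply: commuteM; first exact/commuteV/commute_sym.
  by apply: commuteM; apply: commute_sym.
have [|||F FE] := @graph_product_lift B (fun=> C) (GC A) f.
- by case=> [u|]; rewrite /= ?gmulf1 ?conj1g.
- by case=> [u|] g h; rewrite /= gmulfM ?conjMg.
- case=> [u|] [v|] g h uv.
  + exact: gen_commute.
  + by apply/commute_sym/fz; rewrite adj_sym.
  + exact: fz.
  + by rewrite adj_irrefl in uv.
by exists F; split=> *; rewrite FE.
Qed.

Fact deletion_morphism :
  exists F : UMagmaMorphism.type (GC A) (GC B),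
    forall (u : old_vertex) c, F (vgen (val u : A) c) = vgen (old u) c.
Proof.
have [|F FE] := @vertex_map C A B (fun v => omap old (insub v)).
  move=> u v u' v' uv.
  case: insubP => //= a _ Ea [<-]; case: insubP => //= b _ Eb [<-].
  by move: uv; rewrite -Ea -Eb.
by exists F => u c; rewrite FE valK.
Qed.

Let is_old (v : B) := isSome v.

Section Injectivity.
Variables (phi : UMagmaMorphism.type (GC B) (GC A))
  (beta : UMagmaMorphism.type (GC A) (GC B)).
Hypotheses
  (phi_old : forall (u : old_vertex) c,
    phi (vgen (old u) c) = vgen (val u : A) c)
  (phi_z : forall c, phi (vgen z c) = vgen (x : A) c ^ vgen (t : A) tau).
Hypothesis beta_old :
  forall (u : old_vertex) c, beta (vgen (val u : A) c) = vgen (old u) c.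

Let beta_phi g : supported is_old g -> beta (phi g) = g.
Proof.
elim/supported_ind => [|[u|] c h // _ IHh]; first by rewrite !gmulf1.
by rewrite !gmulfM IHh phi_old beta_old.
Qed.

Let phi_supported (S : pred A) g : (forall u : old_vertex, S (val u)) ->
  supported is_old g -> supported S (phi g).
Proof.
move=> Sold; elim/supported_ind => [|[u|] c h // _ IHh].
  by rewrite gmulf1; apply: supported1.
rewrite gmulfM; apply: supportedM => //.
by rewrite phi_old; apply: supported_gen.
Qed.

(** Applying both retractions to k leaves only common neighbours of x and t, which are the
    neighbours of z. *)
Let beta_supported k : supported (adj (x : A)) k -> supported (adj (t : A)) k ->
  supported (adj z) (beta k).
Proof.
move=> supx supt; rewrite -supx -supt.
elim/graph_product_ind: {supx supt}k => [|v c h IHh].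
  by rewrite !gmulf1; apply: supported1.
rewrite !gmulfM; apply: supportedM => //.
rewrite retractionE; case: ifP => [tv|_]; last first.
  by rewrite !gmulf1; apply: supported1.
rewrite retractionE; case: ifP => [xv|_]; last first.
  by rewrite gmulf1; apply: supported1.
have vP : (v != x) && (v != t).
  by apply/andP; split; apply/eqP => E;
      [move: xv | move: tv]; rewrite E /= /opp_adj eqxx.
rewrite -[v]/(val (exist _ v vP : old_vertex)) beta_old.
by apply: supported_gen; rewrite adj_B_z; apply/andP.
Qed.

(* Write k for phi k and T for tau at t. T k T^-1 lies in <link x>, which     *)
(* avoids t, and killing t maps it to k; so k = T k T^-1 lies in <link x>,    *)
(* and commutes with T, hence lies in <link t>.                               *)
Let label_inj k : supported is_old k ->
  supported (adj (x : A)) (phi k ^ (vgen (t : A) tau)^-1) ->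
  supported (adj z) k.
Proof.
set T := vgen _ tau => supk supx.
have supt : supported (predC1 (t : A)) (phi k).
  by apply: phi_supported => // u; have /andP[] := valP u.
have phik : phi k ^ T^-1 = phi k.
  have <- : supported (predC1 (t : A)) (phi k ^ T^-1).
    apply: supportedS supx => v xv.
    by apply/eqP => /= vt; rewrite vt adj_A_xt in xv.
  by rewrite gmulfJ gmulfV retractionE /= eqxx invg1 conjg1.
rewrite phik in supx; rewrite -(beta_phi supk); apply: beta_supported => //.
apply: (commute_supported tau1 supt).
by rewrite /commute -{1}phik conjgE invgK !mulgA mulgVK.
Qed.

Variable act : UMagmaMorphism.type (GC A) (endo (reduced_word C A)).
Hypotheses
  (act_x : forall c w,
    val (act (vgen (x : A) c) w) = twist (@link_coset C A x) c (val w))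
  (act_supported : forall k w, supported (predC1 (x : A)) k ->
    val (act k w) = relabel (translate k) (val w)).

Local Notation T := (vgen (t : A) tau).

Let r := @retraction C B is_old.

(* Composing with r makes (k, c) a valid syllable for every k : GC B.         *)
Let conj_syllable (a : GC B * C) : GC B := vgen z a.2 ^ (r a.1)^-1.

Let conj_label (a : GC B * C) : coset_label C A * C :=
  (translate (phi (r a.1) * T^-1) (@link_coset C A x), a.2).

Let syllable_prod (l : seq (GC B * C)) : GC B :=
  foldr (fun a g => conj_syllable a * g) 1 l.

Let syllable_prod_mul u c l :
  syllable_prod [seq (vgen (old u) c * a.1, a.2) | a <- l] =
  syllable_prod l ^ (vgen (old u) c)^-1.
Proof.
elim: l => [|a l IHl] /=; first by rewrite conj1g.
rewrite IHl conjMg /conj_syllable /= gmulfM retractionE /= invgM.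
by rewrite conjgM.
Qed.

Let actT (w : reduced_word C A) :
  val (act T w) = relabel (translate T) (val w).
Proof. by apply/act_supported/supported_gen; rewrite /= tx. Qed.

Let actTV (w : reduced_word C A) :
  val (act T^-1 w) = relabel (translate T^-1) (val w).
Proof. by apply/act_supported/supportedV/supported_gen; rewrite /= tx. Qed.

(** Conjugating by T moves the twist from <link x> to T^-1 <link x>. *)
Let act_phi_z c (w : reduced_word C A) :
  val (act (phi (vgen z c)) w) =
  twist (translate T^-1 (@link_coset C A x)) c (val w).
Proof.
rewrite phi_z conjgE !gmulfM.
rewrite -[(act T^-1 * _) w]/(act T^-1 (act (vgen (x : A) c) (act T w))).
rewrite actTV act_x actT relabel_twist; last exact: translate_inj.
rewrite relabel_comp -translateM mulVg translate1.
by congr twist; rewrite /relabel -[RHS]map_id; apply: eq_map => -[].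
Qed.

Let act_phi_old u c (w : reduced_word C A) :
  val (act (phi (vgen (old u) c)) w) =
  relabel (translate (vgen (val u : A) c)) (val w).
Proof.
have /andP[ux _] := valP u.
by rewrite phi_old; apply/act_supported/supported_gen.
Qed.

Let twist_label c l : exists l',
  twist (translate T^-1 (@link_coset C A x)) c (map conj_label l) =
    map conj_label l' /\ vgen z c * syllable_prod l = syllable_prod l'.
Proof.
have new d l0 : exists l',
    attach (translate T^-1 (@link_coset C A x)) d (map conj_label l0) =
      map conj_label l' /\ vgen z d * syllable_prod l0 = syllable_prod l'.
  rewrite /attach; case: eqP => [->|_].
    by exists l0; rewrite gmulf1 mul1g.
  exists ((1, d) :: l0) => /=; rewrite /conj_label /conj_syllable /= !gmulf1.
  by rewrite invg1 conjg1 mul1g.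
case: l => [|[k d] l]; first by rewrite /twist /= mulg1; apply: (new c [::]).
rewrite /twist /=; case: eqP => [E|_]; last first.
  by rewrite mulg1; apply: (new c ((k, d) :: l)).
have [l' [El' El]] := new (c * d) l; exists l'; split; rewrite -?El -?El' //.
(* Equal labels put T phi(r k) T^-1 in <link x>, so [r k] lies in <link z> and conjugation by it
   fixes the vertex group of z. *)
suff ->: conj_syllable (k, d) = vgen z d by rewrite mulgA -gmulfM.
rewrite /conj_syllable /=.
have supz : supported (adj z) (r k).
  apply: label_inj; first exact: supported_retraction.
  by rewrite conjgE; move/(translate_link (x : A)): E.
by rewrite conjgE invgK mulgA -(supported_commute d supz) mulgK.
Qed.

(** An old generator passes to the right of the conjugates by changing their conjugators, which
    translates the labels; a generator at z is absorbed by [twist_label]. *)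
Let normal_form g : exists l k,
  [/\ supported is_old k, g = syllable_prod l * k
    & val (act (phi g) (@empty_word C A)) = map conj_label l].
Proof.
elim/graph_product_ind: g => [|v c g [l [k [supk -> E]]]].
  exists [::], 1; split; [exact: supported1 | by rewrite mulg1|].
  by rewrite !gmulf1.
have actM h h' w :
    val (act (phi (h * h')) w) = val (act (phi h) (act (phi h') w)).
  by rewrite !gmulfM.
rewrite actM; case: v c => [u|] c.
  exists [seq (vgen (old u) c * a.1, a.2) | a <- l], (vgen (old u) c * k).
  split; first by apply: supportedM => //; apply: supported_gen.
    by rewrite syllable_prod_mul conjgE invgK !mulgA mulgVK.
  rewrite act_phi_old E /relabel -!map_comp; apply: eq_map => -[h d] /=.
  rewrite /conj_label /= !gmulfM retractionE /= phi_old.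
  by rewrite -mulgA (translateM (vgen (val u : A) c)).
have [l' [El' El]] := twist_label c l.
exists l', k; split=> //; first by rewrite mulgA El.
by rewrite act_phi_z E.
Qed.

Lemma cocontraction_inj : injective phi.
Proof.
apply: gmulf_inj => g phig1; have [l [k [supk Eg E]]] := normal_form g.
move: E Eg; rewrite phig1 gmulf1; case: l => // _ /=; rewrite mul1g => Eg.
by rewrite Eg -(beta_phi supk) -Eg phig1 gmulf1.
Qed.

End Injectivity.
End Contraction.

(** * Sequences of contractions *)

Section Embedding.
Variables (C : groupType) (tau : C).
Hypothesis tau1 : tau != 1.
Local Notation GC A := (graph_product (fun _ : vertex A => C)).

Definition embeds (A B : sgraph) :=
  exists f : {multiplicative GC B -> GC A}, injective f.

Lemma embeds_trans A B D : embeds A B -> embeds B D -> embeds A D.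
Proof.
by move=> [f f_inj] [g g_inj]; exists (f \o g); apply: inj_comp.
Qed.

Lemma embeds_contract (P : sgraph) (x t : P) :
  adj x t -> embeds (opp_graph P) (opp_graph (contract x t)).
Proof.
move=> xt; have [phi [phi_old phi_z]] := @cocontraction_morphism C P x t tau.
have [beta beta_old] := @deletion_morphism C P x t.
have [act [act_x act_supported]] := @reduced_word_action C (opp_graph P) x.
exists phi; exact: (cocontraction_inj xt tau1 phi_old phi_z beta_old act_x).
Qed.

Lemma embeds_iso A B : sgraph_iso A B -> embeds A B /\ embeds B A.
Proof.
move=> [f [f' fK f'K] f_adj].
have [|F FE] := @vertex_map C A B (fun v => Some (f v)).
  by move=> u v _ _ uv [<-] [<-]; rewrite f_adj.
have [|F' FE'] := @vertex_map C B A (fun v => Some (f' v)).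
  by move=> u v _ _ uv [<-] [<-]; rewrite -f_adj !f'K.
have FK : cancel F F'.
  apply: (@graph_product_ext _ _ _ (F' \o F) idfun) => v c.
  by rewrite /= FE FE' fK.
have F'K : cancel F' F.
  apply: (@graph_product_ext _ _ _ (F \o F') idfun) => v c.
  by rewrite /= FE' FE f'K.
by split; [exists F' | exists F]; apply: can_inj; eassumption.
Qed.

Lemma opp_graph_iso A B :
  sgraph_iso A B -> sgraph_iso (opp_graph A) (opp_graph B).
Proof.
move=> [f f_bij f_adj]; exists f => // u v.
by rewrite /adj /= /opp_adj f_adj (bij_eq f_bij).
Qed.

Lemma opp_graphK A : sgraph_iso (opp_graph (opp_graph A)) A.
Proof.
exists id => [|u v]; first by exists id.
rewrite {2}/adj /= /opp_adj /= negb_and !negbK.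
by case: eqVneq => // ->; rewrite adj_irrefl.
Qed.

Lemma embeds_contracts_onto (P Q : sgraph) :
  contracts_onto P Q -> embeds (opp_graph P) (opp_graph Q).
Proof.
elim=> [A B /opp_graph_iso/embeds_iso[] //|A B x t xt _].
exact/embeds_trans/embeds_contract.
Qed.

Lemma embeds_co_contracts_onto (A B : sgraph) :
  co_contracts_onto A B -> embeds A B.
Proof.
move=> /embeds_contracts_onto AB.
have [_ AoA] := embeds_iso (opp_graphK A).
have [oBB _] := embeds_iso (opp_graphK B).
exact: embeds_trans (embeds_trans AoA AB) oBB.
Qed.

End Embedding.

Theorem theorem5 (Gamma1 Gamma2 : sgraph) (m : option nat) :
  co_contracts_onto Gamma1 Gamma2 ->
  (if m is Some n then 2 <= n else true) ->
  exists f : {multiplicative GP m Gamma2 -> GP m Gamma1}, injective f.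
Proof.
move=> cc _; have [tau tau1] : exists tau : cyclic_group m, tau != 1.
  case: m => [n|] /=; last by exists (Posz 1).
  (* [n.-2.+2] is the modulus in the definition of ['Z_n]; the group is additive, so the residue 1
     differs from its identity. *)
  by exists (@Ordinal n.-2.+2 1 isT).
exact: (embeds_co_contracts_onto tau1 cc).
Qed.
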